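(* Let $n\ge1$, $1\le k\le n$, and let $X_1,\ldots,X_n$ be positive random variables with upper order statistics $X_{1,n}\ge\cdots\ge X_{n,n}$, satisfying $$\lim_{t\to\infty}\frac{\mathbb{P}(X_i>t)}{\mathbb{P}(X_1>t)}=\lambda_i\in[0,\infty)\quad\text{for all } i\in\{1,\ldots,n\},$$ and set $\widetilde\lambda_n=\sum_{i=1}^n\lambda_i$. Let $\mathbf{C}=(C_1,\ldots,C_n)$ be a random vector independent of $(X_1,\ldots,X_n)$ with $C_1>0$, and let $L(\mathbf{C})=\sum_{i=1}^k C_iX_{i,n}$. Suppose that $$\lim_{t\to\infty}\frac{\mathbb{P}(X_1>tx)}{\mathbb{P}(X_1>t)}=x^{-\alpha}\quad\text{for all }x>0,$$ with $\alpha\ge 0$, and $\mathbb{E}[C_1^\beta]<\infty$ for some $\beta\in(\alpha,\infty)$. Suppose $$\lim_{t\to\infty}\max_{1\le i<j\le n}\frac{\mathbb{P}(X_i>t,\ X_j>t)}{\mathbb{P}(X_1>t)}=0,$$ and $\mathbb{E}\big[\max_{2\le i\le n}|C_i|^\gamma\big]\in(0,\infty)$ for some $\gamma\in(\alpha,\infty)$. Then, as $t\to\infty$, $$\mathbb{P}(L(\mathbf{C})>t)\sim\mathbb{P}(C_1X_{1,n}>t)\sim \mathbb{P}(X_1>t)\,\mathbb{E}[C_1^\alpha]\,\widetilde\lambda_n,$$ and moreover $$\mathbb{P}(L(\mathbf{C})>t)\sim\sum_{i=1}^n\mathbb{P}(C_iX_{i,n}>t).$$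
   Context: For positive functions $a,b$, $a(t)\sim c\,b(t)$ means $\lim_{t\to\infty}a(t)/b(t)=c$ for a positive constant $c$. *)

(* Defs.v *)
From HB Require Import structures.
From mathcomp Require Import all_boot all_order all_algebra.
From mathcomp Require Import all_classical all_reals all_analysis.
Set Implicit Arguments. Unset Strict Implicit. Unset Printing Implicit Defensive.
Import Order.TTheory GRing.Theory Num.Theory.
Import numFieldNormedType.Exports.
Local Open Scope classical_set_scope.
Local Open Scope ring_scope.

Section Defs.
Context {d : measure_display} {T : measurableType d} {R : realType}.

(* Upper order statistics: [ostat X i w] is X_{i+1,n}(w), the (i+1)-th
   largest among X_0 w, ..., X_{n-1} w (0-based index i). *)
Definition ostat (n : nat) (X : 'I_n -> T -> R) (i : nat) (w : T) : R :=
  nth 0 (sort (fun x y : R => y <= x) [seq X j w | j <- enum 'I_n]) i.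

Definition sigma_gen (n : nat) (X : 'I_n -> T -> R) : set (set T) :=
  <<s [set A | exists i B, measurable B /\ A = X i @^-1` B] >>.

Definition indep_vec (P : probability T R) (n m : nat)
  (X : 'I_n -> T -> R) (C : 'I_m -> T -> R) : Prop :=
  forall A B, sigma_gen X A -> sigma_gen C B ->
    P (A `&` B) = (P A * P B)%E.

Definition Pr (P : probability T R) (A : set T) : R := fine (P A).

End Defs.

Definition asym_equiv {R : realType} (a b : R -> R) (c : R) : Prop :=
  (fun t => a t / b t) @ +oo --> c.

(* Main.v *)
Require Import Defs.
From HB Require Import structures.
From mathcomp Require Import all_boot all_order all_algebra.
From mathcomp Require Import all_classical all_reals all_analysis.
From mathcomp Require Import measurable_realfun.
From mathcomp Require Import lra.
Import Order.TTheory GRing.Theory Num.Theory.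
Import numFieldNormedType.Exports.
Local Open Scope classical_set_scope.
Local Open Scope ring_scope.

(** Conditionally on [C], a product [U * V] with [U] a function of [C] and [V]
an order statistic has tail [E (G (t / U))], [G] being the tail of [V].
Regular variation makes [G (t / u) / F t] converge to [c * u `^ alpha] when
[G ~ c F], and iterating the bound [F (t / 2) <= 2 `^ beta * F t] shows that it
is at most [K (1 + u `^ beta)], so dominated convergence gives Breiman's lemma.
It applies to the maximum, whose tail is [sum_i lambda_i] times that of [X_1]
because two variables are rarely large together, and with [c = 0] to the second
largest one.  The terms of [L(C)] of index at least [2] are dominated by the
second largest variable times [max(1, max_i |C_i|)], and hence negligible. *)

(** * Real-valued probabilities and union bounds *)

Section Pr_theory.
Context {d : measure_display} {T : measurableType d} {R : realType}.
Variable P : probability T R.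

Lemma PrK {A : set T} : measurable A -> (Pr P A)%:E = P A.
Proof. by move=> mA; rewrite /Pr fineK// fin_num_measure. Qed.

Lemma Pr_ge0 (A : set T) : 0 <= Pr P A.
Proof. exact: fine_ge0. Qed.

Lemma Pr_le1 {A : set T} : measurable A -> Pr P A <= 1.
Proof. by move=> mA; rewrite -lee_fin PrK// probability_le1. Qed.

Lemma le_Pr {A B : set T} :
  measurable A -> measurable B -> A `<=` B -> Pr P A <= Pr P B.
Proof. by move=> mA mB AB; rewrite -lee_fin !PrK// le_measure ?inE. Qed.

Lemma PrU {A B : set T} : measurable A -> measurable B ->
  Pr P (A `|` B) = Pr P A + Pr P B - Pr P (A `&` B).
Proof.
move=> mA mB; apply: EFin_inj; rewrite EFinB EFinD !PrK//.
- by rewrite measureUfinl// -ge0_fin_numE// fin_num_measure.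
- exact: measurableI.
- exact: measurableU.
Qed.

Lemma Pr_setU_le {A B : set T} : measurable A -> measurable B ->
  Pr P (A `|` B) <= Pr P A + Pr P B.
Proof. by move=> mA mB; rewrite PrU// gerBl Pr_ge0. Qed.

Lemma Pr_bigsetU_le {I : Type} (r : seq I) (p : pred I) (A : I -> set T) :
  (forall i, measurable (A i)) ->
  Pr P (\big[setU/set0]_(i <- r | p i) A i) <= \sum_(i <- r | p i) Pr P (A i).
Proof.
move=> mA; elim: r => [|i r IH].
  by rewrite !big_nil /Pr measure0.
rewrite !big_cons; case: ifP => // _.
by rewrite (le_trans (Pr_setU_le _ _))// ?lerD2l//; exact: bigsetU_measurable.
Qed.

Lemma measurable_lt {f : T -> R} (t : R) :
  measurable_fun setT f -> measurable [set w | t < f w].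
Proof.
move=> mf; have := mf measurableT _ (measurable_itv `]t, +oo[%R).
rewrite setTI; congr measurable; apply/seteqP; split => w /=;
  by rewrite in_itv/= andbT.
Qed.

End Pr_theory.

(** * Order statistics through counting *)

Section order_statistics.
Context {R : realType}.

(** In the decreasing list the entries above [t] form a prefix, whose length is the count. Beyond
    the end of the list [nth] returns the default [0], which is not above [t] when [0 <= t]; hence
    the side condition. *)
Lemma lt_nth_sort_ge (s : seq R) (t : R) (i : nat) : (i < size s)%N || (0 <= t) ->
  (t < nth 0 (sort (fun x y : R => y <= x) s) i) =
  (i < count (fun x => (t < x)%R) s)%N.
Proof.
have tot : total (fun x y : R => y <= x) by move=> x y; exact: le_total.
rewrite -(size_sort (fun x y : R => y <= x)).
rewrite -(count_sort (fun x y : R => y <= x) (fun x => t < x)).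
have := sort_sorted tot s; move: (sort _ s) => {}s.
elim: s i => [|x s IH] i /=.
  by move=> _; rewrite nth_nil ltn0 ltNge => ->.
move=> xs; have xall := order_path_min (fun x y z xy yz => le_trans yz xy) xs.
have {}IH := IH ^~ (path_sorted xs).
have [tx|xt] := ltP t x; first by case: i => //= i; rewrite ltnS add1n ltnS; exact: IH.
have c0 : count (fun x0 => t < x0) s = 0%N.
  apply/eqP; rewrite -leqn0 leqNgt -has_count; apply/hasPn => y ys.
  by rewrite -leNgt (le_trans _ xt)//; apply: (allP xall).
case: i => [|i] /=; first by rewrite c0 ltNge xt.
by rewrite ltnS => /IH ->; rewrite c0.
Qed.


Context {d : measure_display} {T : measurableType d}.

Lemma lt_ostatE (n : nat) (X : 'I_n -> T -> R) (i : nat) (t : R) (w : T) :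
  (i < n)%N || (0 <= t) ->
  (t < ostat X i w) = (i < #|[set j : 'I_n | (t < X j w)%R]%SET|)%N.
Proof.
move=> it; rewrite /ostat lt_nth_sort_ge; last by rewrite size_map size_enum_ord.
rewrite count_map -sum1_count -sum1_card big_enum_cond/=; congr (_ < _)%N.
by apply: eq_bigl => j; rewrite inE.
Qed.

(** By the counting criterion, the events [t < ostat X i w] are superlevel sets of a sum of
    indicators. *)
Lemma measurable_ostat (n : nat) (X : 'I_n -> T -> R) (i : nat) :
  (forall j, measurable_fun setT (X j)) -> measurable_fun setT (ostat X i).
Proof.
(* An index past the end is treated apart: the statistic is then constantly [0], and the counting
   criterion fails for negative [t]. *)
move=> mX; have [iltn|nlei] := ltnP i n; last first.
  rewrite (_ : ostat X i = cst 0); first exact: measurable_cst.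
  by apply/funext => w; rewrite /ostat nth_default// size_sort size_map size_enum_ord.
apply: (measurability _ (RGenOInfty.measurableE R)) => _ [_ [t ->] <-].
rewrite setTI.
rewrite (_ : _ @^-1` _ =
  [set w | i%:R < \sum_(j <- enum 'I_n) (\1_[set w | t < X j w] w : R)]).
  apply: measurable_lt; apply: measurable_sum => j.
  by apply: measurable_indic; exact: measurable_lt.
have E w : (t < ostat X i w) =
    (i%:R < \sum_(j <- enum 'I_n) (\1_[set w | t < X j w] w : R)).
  rewrite lt_ostatE ?iltn// -(ltr_nat R) -sum1_card natr_sum big_mkcond/=.
  rewrite big_enum/=; congr (_ < _); apply: eq_bigr => j _; rewrite indicE inE.
  case: ifPn => tX; first by rewrite mem_set.
  by rewrite memNset//=; apply/negP.
by apply/seteqP; split => w /=; rewrite in_itv/= andbT E.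
Qed.

Lemma ostat_ge0 (n : nat) (X : 'I_n -> T -> R) (i : nat) (w : T) :
  (forall l, 0 < X l w) -> 0 <= ostat X i w.
Proof.
move=> X0; rewrite /ostat; set s := sort _ _; have [si|si] := ltnP i (size s).
  have : nth 0 s i \in s by exact: mem_nth.
  by rewrite mem_sort => /mapP[l _ ->]; exact: ltW.
by rewrite nth_default.
Qed.

(** Counting at the level [ostat X i w] excludes the opposite inequality. Positivity of the
    variables makes this level nonnegative, so that indices out of range are covered. *)
Lemma ostat_le (n : nat) (X : 'I_n -> T -> R) (i j : nat) (w : T) :
  (forall l, 0 < X l w) -> (i <= j)%N -> ostat X j w <= ostat X i w.
Proof.
move=> X0 ij; rewrite leNgt; apply/negP => ji.
have s0 := ostat_ge0 n X i w X0.
by move: ji (ltxx (ostat X i w)); rewrite !lt_ostatE ?s0 ?orbT// => /(leq_ltn_trans ij) ->.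
Qed.

End order_statistics.

(** * Tail of a product of independent variables *)

Section independence.
Context {d : measure_display} {T : measurableType d} {R : realType}.
Variable P : probability T R.

(** The premise is measurability of [f] on [T] equipped with the sigma-algebra generated by [X], so
    that measurability lemmas valid on any space also show that [f] is a function of [X]. *)
Lemma sigma_gen_preimage (n : nat) (X : 'I_n -> T -> R) (f : T -> R) :
  let G := [set A | exists i B, measurable B /\ A = X i @^-1` B] in
  ((forall i, measurable_fun (setT : set (g_sigma_algebraType G)) (X i)) ->
    measurable_fun (setT : set (g_sigma_algebraType G)) f) ->
  forall B, measurable B -> sigma_gen X (f @^-1` B).
Proof.
move=> G mf B mB; rewrite -[X in sigma_gen _ X]setTI.
apply: mf => //= i _ A mA; rewrite setTI; apply: sub_sigma_algebra.
by exists i, A.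
Qed.

Variables (U V : T -> R).
Hypotheses (mU : measurable_fun setT U) (mV : measurable_fun setT V).

Let mixU := isMeasurableFun.Build _ _ _ _ U mU.
Let mixV := isMeasurableFun.Build _ _ _ _ V mV.
Let mfU : {mfun T >-> R} := HB.pack U mixU.
Let mfV : {mfun T >-> R} := HB.pack V mixV.

Let hyperbola (t : R) : set (R * R) := [set z | t < z.1 * z.2].

Let measurable_hyperbola t : measurable (hyperbola t).
Proof.
by apply: measurable_lt; apply: measurable_funM;
  [exact: measurable_fst|exact: measurable_snd].
Qed.

(** The event depends on [w] through [U w] only: its probability is the law of [V] on the section of
    the hyperbola at [U w]. *)
Lemma measurable_P_lt_mul (t : R) :
  measurable_fun setT (fun w => P [set w' | t < U w * V w']).
Proof.
have := measurable_fun_xsection (distribution P mfV) (measurable_hyperbola t).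
move=> /measurableT_comp/(_ mU); apply: eq_measurable_fun => w _ /=.
rewrite /distribution /pushforward /=; congr (P _).
by apply/seteqP; split => w' /=; rewrite /xsection/= ?inE.
Qed.

Hypothesis UV : forall A B, measurable A -> measurable B ->
  P (U @^-1` A `&` V @^-1` B) = (P (U @^-1` A) * P (V @^-1` B))%E.

(** Independence identifies the law of the pair with the product of the two laws; the product
    measure is then computed by sections. *)
Lemma P_lt_mul_indep (t : R) :
  P [set w | t < U w * V w] = (\int[P]_w P [set w' | (t < U w * V w')%R])%E.
Proof.
have mUV : measurable_fun setT (fun w => (U w, V w)) by exact: measurable_fun_pair.
pose mixUV := isMeasurableFun.Build _ _ _ _ _ mUV.
pose mfUV : {mfun T >-> (R * R)%type} := HB.pack (fun w => (U w, V w)) mixUV.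
have := @product_measure_unique _ _ _ _ _ (distribution P mfU) (distribution P mfV)
  (distribution P mfUV) UV _ (measurable_hyperbola t).
move=> E; transitivity (distribution P mfUV (hyperbola t)); first by [].
rewrite -E.
rewrite /product_measure1 ge0_integral_distribution/=; last 2 first.
  exact: measurable_fun_xsection.
  by move=> x; exact: measure_ge0.
apply: eq_integral => w _ /=; rewrite /distribution /pushforward /=; congr (P _).
by apply/seteqP; split => w' /=; rewrite /xsection/= ?inE.
Qed.

End independence.

(** * Uniform bounds for regularly varying tails *)

Section regular_variation.
Context {R : realType}.
Variables (F : R -> R) (alpha : R).
Hypotheses (F_gt0 : forall t, 0 < F t) (F_le1 : forall t, F t <= 1).
Hypothesis F_noninc : forall s t, s <= t -> F t <= F s.
Hypothesis F_rv : forall x, 0 < x ->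
  asym_equiv (fun t => F (t * x)) F (x `^ (- alpha)).

(** A weak form of Potter's bound, obtained by halving [t] repeatedly down to a threshold. It holds
    for every [u > 0], as a dominating function must. *)
Lemma potter_bound (beta : R) : 0 <= alpha -> alpha < beta ->
  exists K t1, 0 <= K /\
    forall t u, t1 <= t -> 0 < u -> F (t / u) <= K * (1 + u `^ beta) * F t.
Proof.
move=> alpha0 alphabeta; have beta0 : 0 <= beta by rewrite (le_trans alpha0)// ltW.
(* The ratio tends to 2 to the power [alpha], and [alpha < beta] leaves room. *)
have halving : \forall t \near +oo, F (t / 2) <= 2 `^ beta * F t.
  have lim2 := F_rv 2^-1 ltac:(by rewrite invr_gt0).
  have lt2 : 2^-1 `^ (- alpha) < 2 `^ beta :> R.
    rewrite -powR_inv1// -powRrM mulN1r opprK.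
    rewrite -ltr_ln ?posrE ?powR_gt0// !ln_powR ltr_pM2r// ln_gt0//.
    by rewrite ltr1n.
  near=> t; rewrite -ler_pdivrMr//; apply/ltW; near: t.
  exact: (cvgr_lt _ lim2).
have [t0 [_ {}halving]] := halving.
(* The [1] makes [t1] positive; [t0 + 1] turns the strict inequality [t0 < t] into [t1 <= t]. *)
pose t1 := Num.max 1 (t0 + 1).
have t1_gt0 : 0 < t1 by rewrite /t1 lt_max ltr01.
have {}halving t : t1 <= t -> F (t / 2) <= 2 `^ beta * F t.
  by move=> tt; apply: halving; rewrite (lt_le_trans _ tt)// /t1 lt_max ltrDl ltr01 orbT.
pose K := (F t1)^-1.
have K1 : 1 <= K by rewrite /K -invr1 lef_pV2 ?posrE.
have K0 : 0 < K by rewrite (lt_le_trans ltr01).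
(* Induction on [m] halves [t] and [u] together, which preserves [t / u]. The factor [2 * u], rather
   than [u], pays for one more halving when [t / 2] falls below [t1]. *)
have dyadic m t u : t1 <= t -> 2^-1 <= u -> u <= 2 ^+ m ->
    F (t / u) <= K * (2 * u) `^ beta * F t.
  elim: m t u => [|m IH] t u tt u2 um;
      have u0 : 0 < u by rewrite (lt_le_trans _ u2)// invr_gt0.
    have t_gt0 : 0 < t by rewrite (lt_le_trans _ tt).
    rewrite (@le_trans _ _ (F t))//.
      by apply: F_noninc; rewrite ler_pdivlMr// ler_piMr// ltW.
    rewrite ler_peMl ?(ltW (F_gt0 _))//; apply: mulr_ege1 => //.
    have u21 : 1 <= 2 * u by rewrite mulrC -ler_pdivrMr// div1r.
    by rewrite -[leLHS](powRr0 (2 * u)) ler_powR.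
  have t_gt0 : 0 < t by rewrite (lt_le_trans _ tt).
  have [u1|u1] := leP u 1.
    by apply: IH => //; rewrite (le_trans u1)// exprn_ege1// ler1n.
  have [t2|t2] := leP t1 (t / 2).
    have -> : t / u = (t / 2) / (u / 2).
      by rewrite invf_div mulrA divfK.
    rewrite (le_trans (IH _ (u / 2) t2 _ _))//.
    - by rewrite ler_pdivlMr// mulVf// ltW.
    - by rewrite ler_pdivrMr// -exprSr.
    rewrite [2 * (u / 2)]mulrC divfK// powRM// ?(ltW u0)//.
    rewrite [K * (_ * _)]mulrCA -!mulrA [leRHS]mulrCA ler_pM2l// [leRHS]mulrCA.
    by rewrite ler_wpM2l ?powR_ge0// halving.
  (* Here [t / 2 < t1]: the trivial bound [1] equals [K * F t1], and [F t1 <= F (t / 2)]. *)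
  rewrite (le_trans (F_le1 _))// -[leLHS](mulVf (lt0r_neq0 (F_gt0 t1))) -/K -mulrA ler_pM2l//.
  rewrite (le_trans (F_noninc _ _ (ltW t2)))// (le_trans (halving _ tt))//.
  rewrite ler_wpM2r ?(ltW (F_gt0 _))//; apply: ge0_ler_powR => //.
  - by rewrite nnegrE.
  - by rewrite nnegrE mulr_ge0// ltW.
  - by rewrite ler_peMr// ltW.
exists (K * 2 `^ beta), t1; split; first by rewrite mulr_ge0 ?powR_ge0// ltW.
move=> t u tt u0; have t_gt0 : 0 < t by rewrite (lt_le_trans _ tt).
have twob : 1 <= 2 `^ beta :> R by rewrite -[leLHS](powRr0 2) ler_powR// ler1n.
have [u2|u2] := leP 2^-1 u.
  have [m um] : exists m, u <= 2 ^+ m.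
    exists (Num.truncn u).+1; rewrite (le_trans (ltW (truncnS_gt u)))//.
    by rewrite -natrX ler_nat ltnW// ltn_expl.
  rewrite (le_trans (dyadic m _ _ tt u2 um))// powRM// ?(ltW u0)// mulrA.
  by rewrite ler_wpM2r ?(ltW (F_gt0 _))// ler_wpM2l// ?mulr_ge0 ?powR_ge0 ?(ltW K0)// lerDr.
rewrite (@le_trans _ _ (F t))//.
  apply: F_noninc; rewrite ler_pdivlMr// ler_piMr// ltW//.
  by rewrite (lt_trans u2)// invf_lt1// ltr1n.
rewrite ler_peMl ?(ltW (F_gt0 _))//; apply: mulr_ege1; first exact: mulr_ege1.
by rewrite lerDl powR_ge0.
Unshelve. all: by end_near. Qed.

(** Far out the ratio is below [c + 1]; elsewhere [G <= 1] and [F] is at least [F (t0 + 1)]. All [t]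
    are covered because the level [t / U w] met in Breiman's lemma may be small even for large
    [t]. *)
Lemma asym_equiv_bounded (G : R -> R) (c : R) : (forall t, G t <= 1) ->
  asym_equiv G F c -> exists2 K, 0 <= K & forall t, G t <= K * F t.
Proof.
move=> G1 GF.
have [t0 [_ Gt]] : \forall t \near +oo, G t / F t < c + 1.
  by apply: (cvgr_lt _ GF); rewrite ltrDl.
exists (Num.max `|c + 1| (F (t0 + 1))^-1); first by rewrite le_max normr_ge0.
move=> t; have [tt|tt] := leP t (t0 + 1).
  rewrite (le_trans (G1 _))// (@le_trans _ _ ((F (t0 + 1))^-1 * F t))//.
    by rewrite mulrC ler_pdivlMr// mul1r F_noninc.
  by rewrite ler_wpM2r ?(ltW (F_gt0 _))// le_max lexx orbT.
rewrite -ler_pdivrMr// le_max (le_trans (ltW (Gt _ _)))//.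
  by rewrite (lt_trans _ tt)// ltrDl.
by rewrite ler_norm.
Qed.

End regular_variation.

(** * Moments and Breiman's lemma *)

Section breiman.
Context {d : measure_display} {T : measurableType d} {R : realType}.
Variable P : probability T R.

Lemma powR_le1D (u a b : R) : 0 <= u -> 0 <= a <= b -> u `^ a <= 1 + u `^ b.
Proof.
move=> u0 /andP[a0 ab]; have [u1|u1] := leP u 1.
  rewrite (@le_trans _ _ 1) ?lerDl ?powR_ge0//.
  have [->|un0] := eqVneq u 0.
    by rewrite /powR eqxx; case: (a == 0).
  by rewrite -[leRHS](powRr0 u) ger_powR// lt_neqAle eq_sym un0 u0.
by rewrite (@le_trans _ _ (u `^ b)) ?lerDr// ler_powR// ltW.
Qed.

Lemma integrable_powR_le (U : T -> R) (a b : R) :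
  measurable_fun setT U -> (forall w, 0 <= U w) -> 0 <= a <= b ->
  (\int[P]_w (U w `^ b)%:E < +oo)%E ->
  P.-integrable setT (fun w => (U w `^ a)%:E).
Proof.
move=> mU U0 ab Ub.
have mUp p : measurable_fun setT (fun w => (U w `^ p)%:E).
  by apply/measurable_EFinP; exact: (measurableT_comp (measurable_powR p) mU).
have iUb : P.-integrable setT (fun w => (U w `^ b)%:E).
  apply/integrableP; split => //.
  by under eq_integral do rewrite /= ger0_norm ?powR_ge0//.
have i1b : P.-integrable setT (fun w => (1 + U w `^ b)%:E).
  exact: (integrableD measurableT (finite_measure_integrable_cst P 1 measurableT) iUb).
apply: (le_integrable measurableT _ _ i1b) => // w _ /=.
rewrite lee_fin !ger0_norm ?addr_ge0 ?powR_ge0//.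
exact: powR_le1D.
Qed.

Variables (F : R -> R) (alpha : R).
Hypotheses (F_gt0 : forall t, 0 < F t) (F_le1 : forall t, F t <= 1).
Hypothesis F_noninc : forall s t, s <= t -> F t <= F s.
Hypothesis F_rv : forall x, 0 < x ->
  asym_equiv (fun t => F (t * x)) F (x `^ (- alpha)).

Variables (U V : T -> R).
Hypotheses (mU : measurable_fun setT U) (mV : measurable_fun setT V).
Hypothesis UV : forall A B, measurable A -> measurable B ->
  P (U @^-1` A `&` V @^-1` B) = (P (U @^-1` A) * P (V @^-1` B))%E.
Hypothesis U_gt0 : forall w, 0 < U w.

(** The quotient factors through [F (t * x)]: one factor is the given limit read at [t * x], the
    other is regular variation. *)
Lemma asym_equiv_scale (G : R -> R) (c x : R) : 0 < x ->
  asym_equiv G F c -> asym_equiv (fun t => G (t * x)) F (c * x `^ (- alpha)).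
Proof.
move=> x0 GF; rewrite /asym_equiv.
have -> : (fun t => G (t * x) / F t) =
    (fun t => (G (t * x) / F (t * x)) * (F (t * x) / F t)).
  by apply/funext => t; rewrite mulrA divfK// gt_eqF.
apply: cvgM; last exact: F_rv.
apply: (cvg_comp (fun t => t * x) (fun t => G t / F t) _ GF).
apply/cvgryPge => A; near=> t.
by rewrite -ler_pdivrMr//.
Unshelve. all: by end_near. Qed.

Lemma breiman (beta c : R) : 0 <= alpha -> alpha < beta ->
  (\int[P]_w (U w `^ beta)%:E < +oo)%E ->
  asym_equiv (fun t => Pr P [set w | t < V w]) F c ->
  asym_equiv (fun t => Pr P [set w | t < U w * V w]) F
    (fine (\int[P]_w (U w `^ alpha)%:E) * c).
Proof.
move=> alpha0 ab Ub VF.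
have [K [t1 [K0 potter]]] := potter_bound F alpha F_gt0 F_le1 F_noninc F_rv beta alpha0 ab.
have V1 t : Pr P [set w | t < V w] <= 1 by apply: Pr_le1; exact: measurable_lt.
have [K' K'0 VK] := asym_equiv_bounded F F_gt0 F_noninc _ _ V1 VF.
have iU : P.-integrable setT (fun w => (U w `^ alpha)%:E).
  apply: (integrable_powR_le U alpha beta) => //; first by move=> w; exact: ltW.
  by rewrite alpha0 ltW.
have iUb : P.-integrable setT (fun w => (U w `^ beta)%:E).
  apply: (integrable_powR_le U beta beta) => //; first by move=> w; exact: ltW.
  by rewrite lexx andbT (le_trans alpha0)// ltW.
have scaleV t w : [set w' | t < U w * V w'] = [set w' | t * (U w)^-1 < V w'].
  by apply/seteqP; split => w' /=; rewrite ltr_pdivrMr// mulrC.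
have mUV t w : measurable [set w' | t < U w * V w'].
  by rewrite scaleV; exact: measurable_lt.
pose f t w : \bar R := (Pr P [set w' | t < U w * V w'] / F t)%:E.
have mf t : measurable_fun setT (f t).
  rewrite (_ : f t = fun w => (P [set w' | (t < U w * V w')%R] * ((F t)^-1)%:E)%E).
    by apply: emeasurable_funM => //; exact: measurable_P_lt_mul.
  by apply/funext => w; rewrite /f EFinM PrK.
have fE t : (Pr P [set w | t < U w * V w] / F t)%:E = (\int[P]_w f t w)%E.
  rewrite EFinM PrK ?P_lt_mul_indep//; last first.
    by apply: measurable_lt; exact: measurable_funM.
  rewrite muleC -ge0_integralZl//.
  - by apply: eq_integral => w _; rewrite muleC /f EFinM PrK.
  - exact: measurable_P_lt_mul.
  - by rewrite lee_fin invr_ge0 ltW.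
(* Dominated convergence works along sequences, so the limit is tested on sequences [v], first those
   staying above [t1], where the Potter bound holds. *)
have seqcase (v : R^nat) : (forall n, t1 <= v n) -> v n @[n --> \oo] --> +oo ->
    Pr P [set w | v n < U w * V w] / F (v n) @[n --> \oo] -->
      fine (\int[P]_w (U w `^ alpha)%:E) * c.
  move=> tv voo.
  have [] := @dominated_convergence _ _ _ P setT measurableT (fun n => f (v n))
    (fun w => (c * U w `^ alpha)%:E) (fun w => (K' * K * (1 + U w `^ beta))%:E).
  - by [].
  - apply/measurable_EFinP; apply: measurable_funM => //.
    exact: (measurableT_comp (measurable_powR alpha) mU).
  - apply: aeW => w _; apply: cvg_EFin; first by near=> n.
    rewrite /f /=.
    (* In this form the limit is that of rescaling by [x = (U w)^-1]. *)
    have -> : U w `^ alpha = (U w)^-1 `^ (- alpha).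
      by rewrite -powR_inv1 ?ltW// -powRrM mulN1r opprK.
    have := asym_equiv_scale _ c (U w)^-1 ltac:(by rewrite invr_gt0) VF.
    move=> /cvg_pinftyP/(_ v voo); apply: cvg_trans.
    by apply: near_eq_cvg; near=> n => /=; rewrite scaleV.
  - rewrite (_ : (fun w => _) = (fun w => (K' * K)%:E * ((1%:E + (U w `^ beta)%:E)))%E);
      last by apply/funext => w; rewrite -EFinD -EFinM.
    apply: integrableZl => //.
    exact: (integrableD measurableT (finite_measure_integrable_cst P 1 measurableT) iUb).
  - apply: aeW => w n _; rewrite /f /= lee_fin ger0_norm; last first.
      by rewrite divr_ge0 ?Pr_ge0// ltW.
    rewrite ler_pdivrMr// scaleV (le_trans (VK _))// -!mulrA ler_wpM2l//.
    by rewrite mulrA; exact: potter.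
  have -> : (\int[P]_w (c * U w `^ alpha)%:E =
      (fine (\int[P]_w (U w `^ alpha)%:E) * c)%:E)%E.
    under eq_integral do rewrite EFinM.
    rewrite integralZl// [in RHS]EFinM [in RHS]muleC fineK//.
    exact: integrable_fin_num.
  by move=> _ _; under eq_fun do rewrite -fE; move/fine_cvg.
apply/cvg_pinftyP => v voo.
(* Truncating a divergent sequence below at [t1] changes only finitely many terms. *)
have v1oo : Num.max (v n) t1 @[n --> \oo] --> +oo.
  apply/cvgryPge => A; move/cvgryPge/(_ A) : voo; apply: filterS => n.
  by rewrite le_max => ->.
have := seqcase (fun n => Num.max (v n) t1) _ v1oo.
move=> /(_ (fun n => ltac:(by rewrite le_max lexx orbT))); apply: cvg_trans.
apply: near_eq_cvg; move/cvgryPge/(_ t1) : voo; apply: filterS => n vn.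
by rewrite max_l.
Unshelve. all: by end_near. Qed.

End breiman.

(** * Calculus of asymptotic equivalence *)

Section asym_equiv_theory.
Context {R : realType}.
Variable F : R -> R.
Hypothesis F_gt0 : forall t, 0 < F t.

Lemma asym_equiv_squeeze0 (G H : R -> R) :
  (forall t, 0 <= G t) -> (\forall t \near +oo, G t <= H t) ->
  asym_equiv H F 0 -> asym_equiv G F 0.
Proof.
move=> G0 GH H0; apply: (squeeze_cvgr _ (cvg_cst 0) H0).
apply: filterS GH => t GH; rewrite divr_ge0// ?(ltW (F_gt0 _))//=.
by rewrite ler_wpM2r// invr_ge0 ltW.
Qed.

Lemma asym_equiv_sum {I : eqType} (r : seq I) (p : pred I) (G : I -> R -> R) (c : I -> R) :
  (forall i, i \in r -> p i -> asym_equiv (G i) F (c i)) ->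
  asym_equiv (fun t => \sum_(i <- r | p i) G i t) F (\sum_(i <- r | p i) c i).
Proof.
move=> Gc; rewrite /asym_equiv; under eq_fun do rewrite mulr_suml.
elim: r Gc => [|i r IH] Gc.
  rewrite big_nil; under eq_fun do rewrite big_nil.
  exact: cvg_cst.
have {}IH := IH (fun j jr => Gc j (mem_behead (s := i :: r) jr)).
have Gci := Gc i (mem_head i r).
rewrite big_cons; case: ifPn => pi.
  rewrite (_ : (fun t => _) =
      (fun t => G i t / F t + \sum_(j <- r | p j) G j t / F t)).
    by apply: cvgD => //; exact: Gci.
  by apply/funext => t; rewrite big_cons pi.
rewrite (_ : (fun t => _) = (fun t => \sum_(j <- r | p j) G j t / F t))//.
by apply/funext => t; rewrite big_cons (negbTE pi).
Qed.

Lemma asym_equiv_ratio (G H : R -> R) (c : R) : c != 0 ->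
  asym_equiv G F c -> asym_equiv H F c -> asym_equiv G H 1.
Proof.
move=> c0 Gc Hc; rewrite /asym_equiv -(divff c0).
rewrite (_ : (fun t => _) = (fun t => (G t / F t) / (H t / F t))).
  by apply: cvgM => //; exact: cvgV.
by apply/funext => t; rewrite invf_div mulrA divfK// gt_eqF.
Qed.

End asym_equiv_theory.

(** * Tails of the two largest order statistics *)

Section order_statistics_tail.
Context {d : measure_display} {T : measurableType d} {R : realType}.
Variables (P : probability T R) (n : nat) (X : 'I_n -> T -> R).
Hypothesis mX : forall i, measurable_fun setT (X i).
Variable F : R -> R.
Hypothesis F_gt0 : forall t, 0 < F t.
Hypothesis pairwise_tail : forall i j, i != j ->
  asym_equiv (fun t => Pr P [set w | t < X i w /\ t < X j w]) F 0.

Let A (t : R) (i : 'I_n) : set T := [set w | t < X i w].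

Let mA t i : measurable (A t i).
Proof. exact: measurable_lt. Qed.

(** Inclusion-exclusion along the list: the overlap of one event with the union of the later ones is
    covered by pairwise intersections, negligible since [uniq s] keeps the indices distinct. *)
Lemma asym_equiv_Pr_bigsetU (lambda : 'I_n -> R) (s : seq 'I_n) : uniq s ->
  (forall i, asym_equiv (fun t => Pr P [set w | t < X i w]) F (lambda i)) ->
  asym_equiv (fun t => Pr P (\big[setU/set0]_(i <- s) [set w | t < X i w])) F
    (\sum_(i <- s) lambda i).
Proof.
move=> + Xl; elim: s => [_|i s IH /= /andP[i_s us]].
  rewrite big_nil /asym_equiv; under eq_fun do rewrite big_nil /Pr measure0 mul0r.
  exact: cvg_cst.
have mU t : measurable (\big[setU/set0]_(j <- s) A t j).
  exact: bigsetU_measurable.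
have overlap : asym_equiv
    (fun t => Pr P (A t i `&` \big[setU/set0]_(j <- s) A t j)) F 0.
  apply: (@asym_equiv_squeeze0 _ _ F_gt0 _
    (fun t => \sum_(j <- s) Pr P [set w | t < X i w /\ t < X j w])).
  - by move=> t; exact: Pr_ge0.
  - near=> t; rewrite big_distrr/=.
    apply: (Pr_bigsetU_le P s xpredT (fun j => A t i `&` A t j)) => j.
    exact: measurableI.
  - rewrite [X in asym_equiv _ _ X](_ : 0 = \sum_(i <- s) (0 : R));
      last by rewrite big1.
    apply: asym_equiv_sum => j js _; apply: pairwise_tail.
    by apply: contraNneq i_s => ->.
rewrite big_cons /asym_equiv.
rewrite (_ : (fun t => _) = (fun t => Pr P (A t i) / F t +
    Pr P (\big[setU/set0]_(j <- s) A t j) / F t -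
    Pr P (A t i `&` \big[setU/set0]_(j <- s) A t j) / F t)); last first.
  by apply/funext => t; rewrite big_cons -mulrDl -mulrBl -PrU.
rewrite -[lambda i + _]subr0; apply: cvgB => //.
by apply: cvgD; [exact: Xl|exact: IH].
Unshelve. all: by end_near. Qed.

Lemma asym_equiv_ostat0 (lambda : 'I_n -> R) :
  (forall i, asym_equiv (fun t => Pr P [set w | t < X i w]) F (lambda i)) ->
  asym_equiv (fun t => Pr P [set w | t < ostat X 0 w]) F (\sum_(i < n) lambda i).
Proof.
move=> /(asym_equiv_Pr_bigsetU _ _ (index_enum_uniq 'I_n)); apply: cvg_trans.
apply: near_eq_cvg; near=> t; have t0 : 0 <= t by []; congr (Pr P _ / _).
rewrite -bigcup_seq; apply/seteqP; split => w /=.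
  move=> [i _ /= ti]; rewrite lt_ostatE ?t0 ?orbT//.
  by apply/card_gt0P; exists i; rewrite inE.
rewrite lt_ostatE ?t0 ?orbT// => /card_gt0P[i]; rewrite inE => ti.
by exists i => //=; rewrite mem_index_enum.
Unshelve. all: by end_near. Qed.

(** When the second largest value exceeds [t], so do two distinct variables, and a union bound over
    pairs applies. *)
Lemma asym_equiv_ostat1 :
  asym_equiv (fun t => Pr P [set w | t < ostat X 1 w]) F 0.
Proof.
pose s := [seq p <- index_enum ('I_n * 'I_n)%type | p.1 != p.2].
apply: (@asym_equiv_squeeze0 _ _ F_gt0 _ (fun t =>
  \sum_(p <- s) Pr P [set w | t < X p.1 w /\ t < X p.2 w])).
- by move=> t; exact: Pr_ge0.
(* For [n <= 1] the statistic of index [1] is the default [0]; a nonnegative level keeps the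
   counting criterion valid. *)
- near=> t; have t0 : 0 <= t by [].
  apply: le_trans (Pr_bigsetU_le P s xpredT (fun p => A t p.1 `&` A t p.2) _).
    apply: le_Pr.
    - by apply: measurable_lt; exact: measurable_ostat.
    - by apply: bigsetU_measurable => p _; exact: measurableI.
    - rewrite -bigcup_seq => w /=; rewrite lt_ostatE ?t0 ?orbT//.
      move=> /card_gt1P[i [j []]]; rewrite !inE => ti tj ij.
      by exists (i, j) => //=; rewrite mem_filter ij mem_index_enum.
  by move=> p; exact: measurableI.
- rewrite [X in asym_equiv _ _ X](_ : 0 = \sum_(i <- s) (0 : R));
      last by rewrite big1.
  apply: asym_equiv_sum => p; rewrite mem_filter => /andP[pp _] _.
  exact: pairwise_tail.
Unshelve. all: by end_near. Qed.

End order_statistics_tail.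

(** * Stability of tails under negligible perturbations *)

Section negligible_perturbation.
Context {d : measure_display} {T : measurableType d} {R : realType}.
Variable P : probability T R.
Variables (F : R -> R) (alpha : R).
Hypothesis F_gt0 : forall t, 0 < F t.
Hypothesis F_rv : forall x, 0 < x ->
  asym_equiv (fun t => F (t * x)) F (x `^ (- alpha)).

(** Unless [m * Z] exceeds [t * eps], an event negligible against [F t], [L] and [W] differ by at
    most [t * eps]. The tail of [L] is thus squeezed between those of [W] at [t * (1 + eps)] and
    [t * (1 - eps)], which regular variation compares. *)
Lemma asym_equiv_perturb (L W Z : T -> R) (m c : R) :
  measurable_fun setT L -> measurable_fun setT W -> measurable_fun setT Z ->
  0 < m -> (forall w, `|L w - W w| <= m * Z w) ->
  asym_equiv (fun t => Pr P [set w | t < W w]) F c ->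
  asym_equiv (fun t => Pr P [set w | t < Z w]) F 0 ->
  asym_equiv (fun t => Pr P [set w | t < L w]) F c.
Proof.
move=> mL mW mZ m0 LW Wc Zc; apply/cvgrPdist_lt => e e0.
(* Continuity at [1] brings the limits of both sides of the squeeze within [e] of [c]. *)
have cont1 : c * x `^ (- alpha) @[x --> (1 : R)] --> c.
  rewrite -[X in _ --> X]mulr1; apply: cvgM; first exact: cvg_cst.
  rewrite -[X in _ --> X](_ : 1 `^ (- alpha) = 1); last by rewrite powR1.
  have : derivable (fun x : R => x `^ (- alpha)) (1 : R) 1.
    by apply: derivable_powR; rewrite in_itv/= ltr01.
  by move=> /derivable1_diffP/differentiable_continuous.
move/cvgrPdist_lt : cont1 => /(_ _ e0)[r /= r0 close1].
(* [r / 2] keeps [1 - eps] and [1 + eps] in the continuity ball; [2^-1] keeps [1 - eps] positive. *)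
pose eps := Num.min (r / 2) (2^-1).
have eps0 : 0 < eps by rewrite lt_min divr_gt0//= invr_gt0.
have eps1 : eps < 1 by rewrite gt_min [X in _ || X]invf_lt1// ltr1n orbT.
have epsr : eps < r by rewrite gt_min ltr_pdivrMr// ltr_pMr// ltr1n.
have tail2 := asym_equiv_scale F alpha F_gt0 F_rv _ _ _ (divr_gt0 eps0 m0) Zc.
have upW := asym_equiv_scale F alpha F_gt0 F_rv _ _ (1 - eps) ltac:(by rewrite subr_gt0) Wc.
have loW := asym_equiv_scale F alpha F_gt0 F_rv _ _ (1 + eps) ltac:(by rewrite addr_gt0) Wc.
rewrite mul0r in tail2.
have up : Pr P [set w | t * (1 - eps) < W w] / F t +
    Pr P [set w | t * (eps / m) < Z w] / F t @[t --> +oo] -->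
    c * (1 - eps) `^ (- alpha).
  by rewrite -[X in _ --> X]addr0; exact: cvgD upW tail2.
have lo : Pr P [set w | t * (1 + eps) < W w] / F t -
    Pr P [set w | t * (eps / m) < Z w] / F t @[t --> +oo] -->
    c * (1 + eps) `^ (- alpha).
  by rewrite -[X in _ --> X]subr0; exact: cvgB loW tail2.
near=> t.
have t0 : 0 < t by [].
have mlt (f : T -> R) s : measurable_fun setT f -> measurable [set w | s < f w].
  exact: measurable_lt.
have upL : Pr P [set w | t < L w] <=
    Pr P [set w | t * (1 - eps) < W w] + Pr P [set w | t * (eps / m) < Z w].
  apply: le_trans (Pr_setU_le P (mlt _ _ mW) (mlt _ _ mZ)); apply: le_Pr.
  - exact: mlt.
  - by apply: measurableU; exact: mlt.
  move=> w /= tL; apply/orP; rewrite -implyNb -leNgt; apply/implyP => Wt.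
  rewrite mulrA ltr_pdivrMr//.
  have LWw := le_trans (ler_norm _) (LW w); lra.
have loL : Pr P [set w | t * (1 + eps) < W w] - Pr P [set w | t * (eps / m) < Z w] <=
    Pr P [set w | t < L w].
  rewrite lerBlDr.
  apply: le_trans (Pr_setU_le P (mlt _ _ mL) (mlt _ _ mZ)); apply: le_Pr.
  - exact: mlt.
  - by apply: measurableU; exact: mlt.
  move=> w /= tW; apply/orP; rewrite -implyNb -leNgt; apply/implyP => Lt.
  rewrite mulrA ltr_pdivrMr//.
  have := LW w; rewrite distrC => /(le_trans (ler_norm _)) WLw; lra.
rewrite distrC ltr_distl; apply/andP; split.
  apply: (@lt_le_trans _ _ (Pr P [set w | t * (1 + eps) < W w] / F t -
      Pr P [set w | t * (eps / m) < Z w] / F t)); last first.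
    by rewrite -mulrBl ler_wpM2r// invr_ge0 ltW.
  near: t; apply: (cvgr_gt _ lo); rewrite ltrBlDr -ltrBlDl.
  apply: le_lt_trans (ler_norm _) _; apply: close1.
  by rewrite /ball/= opprD addNKr normrN gtr0_norm.
apply: (@le_lt_trans _ _ (Pr P [set w | t * (1 - eps) < W w] / F t +
    Pr P [set w | t * (eps / m) < Z w] / F t)).
  by rewrite -mulrDl ler_wpM2r// invr_ge0 ltW.
near: t; apply: (cvgr_lt _ up); rewrite -ltrBlDl.
apply: le_lt_trans (ler_norm _) _; rewrite distrC; apply: close1.
by rewrite /ball/= opprB addrC subrK gtr0_norm.
Unshelve. all: by end_near. Qed.

End negligible_perturbation.

(** * Measurable maxima and positive moments *)

Section bounds.
Context {d : measure_display} {T : measurableType d} {R : realType}.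

Lemma measurable_bigmax {I : Type} (r : seq I) (p : pred I) (f : I -> T -> R) :
  (forall i, measurable_fun setT (f i)) ->
  measurable_fun setT (fun w => \big[Num.max/0]_(i <- r | p i) f i w).
Proof.
move=> mf; elim: r => [|i r IH].
  by rewrite (_ : (fun w => _) = cst 0)//; apply/funext => w; rewrite big_nil.
case: (boolP (p i)) => pi.
  rewrite (_ : (fun w => _) = (f i \max (fun w => \big[Num.max/0]_(i <- r | p i) f i w))).
    exact: measurable_maxr.
  by apply/funext => w; rewrite big_cons pi.
rewrite (_ : (fun w => _) = (fun w => \big[Num.max/0]_(i <- r | p i) f i w))//.
by apply/funext => w; rewrite big_cons (negbTE pi).
Qed.

(** A zero integral would make the power vanish almost everywhere; it vanishes nowhere, so the whole
    space would be null. *)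
Lemma integral_powR_gt0 (P : probability T R) (U : T -> R) (a : R) :
  measurable_fun setT U -> (forall w, 0 < U w) ->
  (0 < \int[P]_w (U w `^ a)%:E)%E.
Proof.
move=> mU U0; rewrite lt_neqAle integral_ge0 ?andbT; last first.
  by move=> w _; rewrite lee_fin powR_ge0.
apply/eqP => /esym int0.
have mUa : measurable_fun setT (fun w => (U w `^ a)%:E).
  by apply/measurable_EFinP; exact: (measurableT_comp (measurable_powR a) mU).
have [+ _] := ae_eq_integral_abs P measurableT mUa.
under eq_integral do rewrite gee0_abs ?lee_fin ?powR_ge0//.
move=> /(_ int0)[N [_ N0 subN]].
have NT : N = setT.
  apply/seteqP; split => // w _; apply: subN => /= /(_ I)[]/eqP.
  by rewrite gt_eqF// powR_gt0.
have := probability_setT P; rewrite -NT.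
by rewrite [P N]N0 => /eqP; rewrite eqe eq_sym oner_eq0.
Qed.

End bounds.

(** * Tail of the randomly weighted sum *)

Theorem theorem2 (d : measure_display) (T : measurableType d) (R : realType)
  (P : probability T R) (n k : nat) (X C : 'I_n -> T -> R)
  (lambda : 'I_n -> R) (alpha beta gamma : R) (i0 : 'I_n) :
  (1 <= n)%N -> (1 <= k <= n)%N -> nat_of_ord i0 = 0%N ->
  (forall i, measurable_fun setT (X i)) ->
  (forall i, measurable_fun setT (C i)) ->
  (forall i w, 0 < X i w) ->
  (forall i, 0 <= lambda i) ->
  (forall i, asym_equiv (fun t => Pr P [set w | t < X i w])
                        (fun t => Pr P [set w | t < X i0 w]) (lambda i)) ->
  indep_vec P X C ->
  (forall w, 0 < C i0 w) ->
  0 <= alpha ->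
  (forall x, 0 < x -> asym_equiv (fun t => Pr P [set w | t * x < X i0 w])
                        (fun t => Pr P [set w | t < X i0 w]) (x `^ (- alpha))) ->
  alpha < beta ->
  (\int[P]_w ((C i0 w) `^ beta)%:E < +oo)%E ->
  (fun t => (\big[Num.max/0]_(i < n) \big[Num.max/0]_(j < n | (i < j)%N)
                Pr P [set w | t < X i w /\ t < X j w])
            / Pr P [set w | t < X i0 w]) @ +oo --> 0 ->
  alpha < gamma ->
  (0 < \int[P]_w ((\big[Num.max/0]_(i < n | (0 < i)%N) `|C i w|) `^ gamma)%:E
     < +oo)%E ->
  let L := fun w => \sum_(i < n | (i < k)%N) C i w * ostat X i w in
  let lambda_tilde := \sum_(i < n) lambda i in
  asym_equiv (fun t => Pr P [set w | t < L w])
             (fun t => Pr P [set w | t < C i0 w * ostat X 0 w]) 1 /\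
  asym_equiv (fun t => Pr P [set w | t < C i0 w * ostat X 0 w])
             (fun t => Pr P [set w | t < X i0 w])
             (fine (\int[P]_w ((C i0 w) `^ alpha)%:E) * lambda_tilde) /\
  asym_equiv (fun t => Pr P [set w | t < L w])
             (fun t => \sum_(i < n) Pr P [set w | t < C i w * ostat X i w]) 1.
Proof.
move=> n1 /andP[k1 kn] i00 mX mC X0 l0 Xl indep C0 alpha0 F_rv alphabeta Cbeta Xpair
  alphagamma /andP[_ Cgamma] L lt.
pose F t := Pr P [set w | t < X i0 w].
have mlt (f : T -> R) s : measurable_fun setT f -> measurable [set w | s < f w].
  exact: measurable_lt.
have F_noninc s t : s <= t -> F t <= F s.
  by move=> st; apply: le_Pr; [exact: mlt|exact: mlt|move=> w /=; exact: le_lt_trans].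
have F_le1 t : F t <= 1 by apply: Pr_le1; exact: mlt.
(* Were [F t] zero, [F] would vanish from [t] on, and by the convention [0^-1 = 0] the ratio at
   [x = 1] would be eventually [0] instead of tending to [1]. *)
have F_gt0 t : 0 < F t.
  rewrite lt_neqAle Pr_ge0 andbT; apply/eqP => Ft0.
  have : \forall s \near +oo, 0 < F (s * 1) / F s.
    by apply: (cvgr_gt _ (F_rv 1 ltr01)); rewrite powR1.
  move=> /filterI/(_ (nbhs_pinfty_ge (num_real t)))/filter_ex[s [+ ts]].
  suff -> : F s = 0 by rewrite invr0 mulr0 ltxx.
  by apply/eqP; rewrite eq_le Pr_ge0 andbT [leRHS]Ft0 F_noninc.
have lambda_i0 : lambda i0 = 1.
  have lim1 : (fun t => F t / F t) @ +oo --> (1 : R).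
    rewrite (_ : (fun t => _) = cst 1); first exact: cvg_cst.
    by apply/funext => t; rewrite divff// gt_eqF.
  by rewrite -(cvg_lim _ (Xl i0))//; exact: cvg_lim lim1.
have lt_gt0 : 0 < lt.
  rewrite /lt (bigD1 i0)//= lambda_i0 ltr_pwDl// sumr_ge0// => i _; exact: l0.
have pairwise_tail i j : i != j ->
    asym_equiv (fun t => Pr P [set w | t < X i w /\ t < X j w]) F 0.
  (* The hypothesis takes the maximum over [i < j] only, but the joint event is symmetric. *)
  wlog ij : i j / (i < j)%N => [wl ij|_].
    have [ij'|ij'] := ltnP i j; first exact: wl.
    have ji : (j < i)%N by rewrite ltn_neqAle ij' andbT eq_sym.
    have -> : (fun t => Pr P [set w | t < X i w /\ t < X j w]) =
        (fun t => Pr P [set w | t < X j w /\ t < X i w]).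
      by apply/funext => t; congr Pr; apply/seteqP; split => w [].
    by apply: wl => //; rewrite eq_sym.
  apply: (asym_equiv_squeeze0 F F_gt0 _ _ _ _ Xpair) => [t|]; first exact: Pr_ge0.
  near=> t; apply: le_trans (le_bigmax_cond _ _ (isT : xpredT i)).
  exact: (le_bigmax_cond _ (fun j => Pr P [set w | t < X i w /\ t < X j w])).
(* The [1] makes [D] positive: at [alpha = 0] the junk value [0 `^ 0 = 1]
   would break the limit in Breiman's lemma. *)
pose D w := Num.max 1 (\big[Num.max/0]_(i < n | (0 < i)%N) `|C i w|).
have D_gt0 w : 0 < D w by rewrite lt_max ltr01.
have D_norm w i : i != i0 -> `|C i w| <= D w.
  move=> ii0; rewrite /D le_max; apply/orP; right.
  apply: (le_bigmax_cond _ (fun i => `|C i w|)).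
  by rewrite lt0n -i00.
(* The [gamma]-th power of a maximum with [1] is at most [1] plus that of the other term. *)
have gD : (\int[P]_w (D w `^ gamma)%:E < +oo)%E.
  have mDg : measurable_fun setT
      (fun w => \big[Num.max/0]_(i < n | (0 < i)%N) `|C i w|).
    by apply: measurable_bigmax => i; exact: measurableT_comp.
  have g0 : 0 <= gamma by rewrite (le_trans alpha0)// ltW.
  have iDg : P.-integrable setT (fun w =>
      ((\big[Num.max/0]_(i < n | (0 < i)%N) `|C i w|) `^ gamma)%:E).
    apply: (integrable_powR_le P _ gamma gamma mDg) => //; last by rewrite g0 lexx.
    by move=> w; exact: bigmax_ge_id.
  have := integrableD measurableT
    (finite_measure_integrable_cst P 1 measurableT) iDg.
  move=> /(integrable_fin_num measurableT).
  rewrite ge0_fin_numE; last first.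
    by apply: integral_ge0 => w _; rewrite adde_ge0// lee_fin ?powR_ge0.
  apply: le_lt_trans; apply: ge0_le_integral => //.
  - by move=> w _; rewrite lee_fin powR_ge0.
  - apply/measurable_EFinP; apply: (measurableT_comp (measurable_powR gamma)).
    by apply: measurable_maxr.
  - by apply/measurable_EFinP; apply: measurable_funD => //;
      exact: (measurableT_comp (measurable_powR gamma) mDg).
  move=> w _; rewrite -EFinD lee_fin /D /=.
  have [m1|m1] := leP 1 (\big[Num.max/0]_(i < n | (0 < i)%N) `|C i w|).
    by rewrite lerDr.
  by rewrite powR1 lerDl powR_ge0.
have indep_ostat (U : T -> R) (i : nat) :
    (forall B, measurable B -> sigma_gen C (U @^-1` B)) ->
    forall A B, measurable A -> measurable B ->
    P (U @^-1` A `&` ostat X i @^-1` B) = (P (U @^-1` A) * P (ostat X i @^-1` B))%E.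
  move=> UC A B mA mB; rewrite setIC muleC; apply: indep; last exact: UC.
  apply: (sigma_gen_preimage n X (ostat X i) _ B mB).
  exact: measurable_ostat.
have m_ostat i : measurable_fun setT (ostat X i) by exact: measurable_ostat.
have mD : measurable_fun setT D.
  apply: measurable_maxr; first exact: measurable_cst.
  by apply: measurable_bigmax => i; exact: measurableT_comp.
have W_tail : asym_equiv (fun t => Pr P [set w | t < C i0 w * ostat X 0 w]) F
    (fine (\int[P]_w (C i0 w `^ alpha)%:E) * lt).
  apply: (breiman P F alpha F_gt0 F_le1 F_noninc F_rv _ _ _ _ _ _ beta) => //.
  - apply: indep_ostat => B mB; apply: (sigma_gen_preimage _ _ _ _ B mB) => mCg.
    exact: mCg.
  - exact: (asym_equiv_ostat0 P n X mX F F_gt0 pairwise_tail).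
have Z_tail : asym_equiv (fun t => Pr P [set w | t < D w * ostat X 1 w]) F 0.
  rewrite -(mulr0 (fine (\int[P]_w (D w `^ alpha)%:E))).
  apply: (breiman P F alpha F_gt0 F_le1 F_noninc F_rv _ _ _ _ _ _ gamma) => //.
  (* Measurability of [D] is proved again, now for the sigma-algebra generated by [C]. *)
  - apply: indep_ostat => B mB; apply: (sigma_gen_preimage _ _ _ _ B mB) => mCg.
    apply: measurable_maxr; first exact: measurable_cst.
    by apply: measurable_bigmax => i; exact: measurableT_comp.
  - exact: (asym_equiv_ostat1 P n X mX F F_gt0 pairwise_tail).
have ostat_bound w i : i != i0 -> `|C i w * ostat X i w| <= D w * ostat X 1 w.
  move=> ii0; have X0w l : 0 < X l w by [].
  rewrite normrM (ger0_norm (ostat_ge0 n X i w X0w)) ler_pM ?ostat_ge0 ?D_norm//.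
  by apply: ostat_le => //; rewrite lt0n -i00.
have L_tail : asym_equiv (fun t => Pr P [set w | t < L w]) F
    (fine (\int[P]_w (C i0 w `^ alpha)%:E) * lt).
  (* Besides the term of [i0], [L] has fewer than [n] terms, each at most [D w * ostat X 1 w] in
     absolute value; hence the factor [n%:R]. *)
  apply: (asym_equiv_perturb P F alpha F_gt0 F_rv L _ _ n%:R _ _ _ _ _ _ W_tail Z_tail).
  - rewrite /L; under eq_fun do rewrite big_mkcond.
    apply: measurable_sum => i; case: (i < k)%N => //; exact: measurable_funM.
  - exact: measurable_funM.
  - exact: measurable_funM.
  - by rewrite ltr0n.
  move=> w; rewrite /L (bigD1 i0) ?i00//= addrAC subrr add0r.
  rewrite (le_trans (ler_norm_sum _ _ _))//.
  rewrite mulr_natl -[X in _ *+ X]card_ord -sumr_const big_mkcond/=.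
  apply: ler_sum => i _; case: ifPn => [/andP[_ ii0]|_]; first exact: ostat_bound.
  by rewrite mulr_ge0 ?ostat_ge0 ?(ltW (D_gt0 w)).
(* Since [fine] sends infinity to [0], a nonzero constant also requires a finite [alpha]-moment,
   which the [beta]-moment provides. *)
have c_neq0 : fine (\int[P]_w (C i0 w `^ alpha)%:E) * lt != 0.
  apply: lt0r_neq0; apply: mulr_gt0 lt_gt0.
  apply: fine_gt0; apply/andP; split; first exact: integral_powR_gt0.
  have := integrable_powR_le P (C i0) alpha beta (mC i0) (fun w => ltW (C0 w)).
  rewrite alpha0 (ltW alphabeta) => /(_ isT Cbeta)/(integrable_fin_num measurableT).
  by rewrite ge0_fin_numE// integral_ge0// => w _; rewrite lee_fin powR_ge0.
split; first exact: (asym_equiv_ratio F F_gt0 _ _ _ c_neq0 L_tail W_tail).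
split; first exact: W_tail.
apply: (asym_equiv_ratio F F_gt0 _ _ _ c_neq0 L_tail).
(* Only the term of [i0] contributes to the sum of tails; the others are dominated by the negligible
   tail of [D w * ostat X 1 w]. *)
have term_tail i : asym_equiv (fun t => Pr P [set w | t < C i w * ostat X i w]) F
    (if i == i0 then fine (\int[P]_w (C i0 w `^ alpha)%:E) * lt else 0).
  case: (eqVneq i i0) => [->|ii0]; first by rewrite i00.
  apply: (asym_equiv_squeeze0 F F_gt0 _ _ _ _ Z_tail) => [t|]; first exact: Pr_ge0.
  near=> t; apply: le_Pr.
  - by apply: mlt; exact: measurable_funM.
  - by apply: mlt; exact: measurable_funM.
  - move=> w /= tC; rewrite (lt_le_trans tC)// (le_trans (ler_norm _))//.
    exact: ostat_bound.
have := asym_equiv_sum F (index_enum 'I_n) xpredT _ _ (fun i _ _ => term_tail i).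
by rewrite -big_mkcond/= big_pred1_eq.
Unshelve. all: by end_near. Qed.
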